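(* Let $F=g+h\circ c$ be the composite function described in the context, with $\mu=L\beta$. For any point $x\in\mathbf{R}^d$ and any real $t>0$, the inequalities hold: $$\frac{1}{(1+\mu t)(1+\sqrt{\mu t})}\left\|\nabla F_{\frac{t}{1+t\mu}}(x)\right\|\;\le\;\left\|\mathcal{G}_t(x)\right\|\;\le\;\frac{1+2t\mu}{1+t\mu}\left(\sqrt{\frac{t\mu}{1+t\mu}}+1\right)\left\|\nabla F_{\frac{t}{1+t\mu}}(x)\right\|.$$
   Context: Setting: $g\colon\mathbf{R}^d\to\mathbf{R}\cup\{+\infty\}$ is proper, closed and convex; $h\colon\mathbf{R}^m\to\mathbf{R}$ is convex and $L$-Lipschitz continuous; $c\colon\mathbf{R}^d\to\mathbf{R}^m$ is $C^1$-smooth with $\|\nabla c(x)-\nabla c(y)\|_{\rm op}\le\beta\|x-y\|$ for all $x,y$. Set $\mu:=L\beta$ and $F(x):=g(x)+h(c(x))$. For $t>0$ define $F_t(z;y):=g(z)+h\big(c(y)+\nabla c(y)(z-y)\big)+\frac{1}{2t}\|z-y\|^2$, $S_t(y):=\operatorname{argmin}_z F_t(z;y)$ (a single point, by strong convexity), and the prox-gradient $\mathcal{G}_t(x):=t^{-1}(x-S_t(x))$. For $\nu>0$ the Moreau envelope of $F$ (written with a single subscript and one argument) is $F_\nu(x):=\inf_z\{F(z)+\frac{1}{2\nu}\|z-x\|^2\}$. For $\nu\in(0,1/\mu)$ (with $1/\mu=+\infty$ if $\mu=0$) the envelope $F_\nu$ is $C^1$-smooth, so its gradient $\nabla F_\nu(x)$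 is well-defined; note $\frac{t}{1+t\mu}<\frac1\mu$. *)

(* Defs.v *)
From HB Require Import structures.
From mathcomp Require Import all_boot all_order all_algebra.
From mathcomp Require Import all_classical all_reals all_analysis.

Set Implicit Arguments.
Unset Strict Implicit.
Unset Printing Implicit Defensive.

Import Order.TTheory GRing.Theory Num.Theory.
Import numFieldNormedType.Exports.

Local Open Scope classical_set_scope.
Local Open Scope ring_scope.

(* Points of R^n are row vectors ['rV[R]_n]; linear
   maps act by right multiplication, so that [jacobian c y : 'M[R]_(d, m)] is
   the transpose of the usual Jacobian matrix and [v *m jacobian c y] is
   the value of the derivative of [c] at [y] in the direction [v]. *)

(* The library norm of ['rV[R]_n] is the sup norm; it induces the same topology
   and the same notion of differentiability. *)
Definition l2norm {R : realType} {n : nat} (v : 'rV[R]_n) : R :=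
  Num.sqrt (\sum_(i < n) v 0 i ^+ 2).

Definition opnorm {R : realType} {d m : nat} (A : 'M[R]_(d, m)) : R :=
  sup [set l2norm (v *m A) | v in [set v : 'rV[R]_d | l2norm v <= 1]].

Definition l2lipschitz {R : realType} {n : nat} (L : R) (h : 'rV[R]_n -> R) :=
  forall u v : 'rV[R]_n, `|h u - h v| <= L * l2norm (u - v).

Definition C1_smooth {R : realType} {d m : nat} (c : 'rV[R]_d -> 'rV[R]_m) :=
  (forall x, differentiable c x) /\ continuous (fun x => jacobian c x).

Definition gradient {R : realType} {n : nat} (f : 'rV[R]_n -> R^o)
    (x : 'rV[R]_n) : 'rV[R]_n :=
  \row_(i < n) ('d f x (delta_mx 0 i)).

Definition epigraph {R : realType} {n : nat} (g : 'rV[R]_n -> \bar R) :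
    set ('rV[R]_n * R^o)%type :=
  [set p | (g p.1 <= (p.2)%:E)%E].

Definition proper_fun {R : realType} {n : nat} (g : 'rV[R]_n -> \bar R) :=
  (forall x, g x != -oo%E) /\ (exists x, g x != +oo%E).

Definition closed_fun {R : realType} {n : nat} (g : 'rV[R]_n -> \bar R) :=
  closed (epigraph g).

Definition convex_efun {R : realType} {n : nat} (g : 'rV[R]_n -> \bar R) :=
  convex_set (epigraph g).

Definition argmin {R : realType} {n : nat} (f : 'rV[R]_n -> \bar R) :
    set 'rV[R]_n :=
  [set z | forall w, (f z <= f w)%E].

Definition composite {R : realType} {d m : nat} (g : 'rV[R]_d -> \bar R)
    (h : 'rV[R]_m -> R) (c : 'rV[R]_d -> 'rV[R]_m) (x : 'rV[R]_d) : \bar R :=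
  (g x + (h (c x))%:E)%E.

Definition prox_linear_model {R : realType} {d m : nat} (g : 'rV[R]_d -> \bar R)
    (h : 'rV[R]_m -> R) (c : 'rV[R]_d -> 'rV[R]_m) (t : R)
    (z y : 'rV[R]_d) : \bar R :=
  (g z + (h (c y + (z - y) *m jacobian c y)
          + 1 / (2 * t) * l2norm (z - y) ^+ 2)%:E)%E.

(* When [g] is proper, closed and convex, [h] is convex and [0 < t], the argmin
   is a single point, which [get] returns. *)
Definition prox_linear_step {R : realType} {d m : nat} (g : 'rV[R]_d -> \bar R)
    (h : 'rV[R]_m -> R) (c : 'rV[R]_d -> 'rV[R]_m) (t : R)
    (y : 'rV[R]_d) : 'rV[R]_d :=
  get (argmin (fun z => prox_linear_model g h c t z y)).

Definition prox_gradient {R : realType} {d m : nat} (g : 'rV[R]_d -> \bar R)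
    (h : 'rV[R]_m -> R) (c : 'rV[R]_d -> 'rV[R]_m) (t : R)
    (x : 'rV[R]_d) : 'rV[R]_d :=
  t^-1 *: (x - prox_linear_step g h c t x).

Definition moreau_envelope {R : realType} {n : nat} (nu : R)
    (f : 'rV[R]_n -> \bar R) (x : 'rV[R]_n) : \bar R :=
  ereal_inf (range (fun z => (f z + (1 / (2 * nu) * l2norm (z - x) ^+ 2)%:E)%E)).

(* [fine] only discards infinite values: the envelopes in use are finite
   everywhere. *)
Definition grad_moreau {R : realType} {n : nat} (nu : R)
    (f : 'rV[R]_n -> \bar R) (x : 'rV[R]_n) : 'rV[R]_n :=
  gradient (fun y => fine (moreau_envelope nu f y)) x.

(* Main.v *)
Require Import Defs.
From HB Require Import structures.
From mathcomp Require Import all_boot all_order all_algebra.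
From mathcomp Require Import all_classical all_reals all_analysis.
From mathcomp Require Import ring lra.

Set Implicit Arguments.
Unset Strict Implicit.
Unset Printing Implicit Defensive.

Import Order.TTheory GRing.Theory Num.Theory.
Import numFieldNormedType.Exports.

Local Open Scope classical_set_scope.
Local Open Scope ring_scope.

(** Write [F = g + h \o c], [mu = L * beta] and [nu = t / (1 + t mu)], so that
    [1/nu = 1/t + mu]. Since [c] has a [beta]-Lipschitz derivative and [h] is
    [L]-Lipschitz, the convex model [z |-> h (c y + (z - y) J)] differs from
    [h \o c] at [z] by at most [mu/2 |z - y|^2] ([linearized_error]). Hence
    [h \o c] is weakly convex with constant [mu], and [F + |. - x|^2 / (2 nu)]
    is strongly convex with constant [1/nu - mu = 1/t]. It has a minimiser [p],
    and the gradient of the Moreau envelope at [x] is [(x - p) / nu]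
    ([grad_moreau_composite]). With [s_tau] the prox-linear step of length
    [tau] from [x], everything becomes a comparison of the three points [x],
    [p] and [s_t]: the two bounds amount to
    [|p - x| <= (1 + sqrt (t mu)) |s_t - x|] and
    [|s_t - x| <= (1 + 2 t mu) (1 + sqrt (t mu / (1 + t mu))) |p - x|].

    A strongly convex function grows quadratically away from its minimiser
    ([argmin_growth]). Adding the growth inequality of the problem solved by [p],
    taken at [s_tau], to that of the problem solved by [s_tau], taken at [p],
    bounds [|s_tau - p|^2] by the model errors at [p] and at [s_tau]
    ([prox_linear_step_gap]). Two values of [tau] cancel one of the errors:
    [tau = t] gives [|s_t - p|^2 <= t mu |s_t - x|^2], and [tau = r] with
    [1/r = 1/t + 2 mu] gives [(1 + t mu) |s_r - p|^2 <= t mu |p - x|^2].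
    The triangle inequality turns the first into the left bound, and the
    second into a bound on [|s_r - x|]. The right bound follows because the step
    length grows at most linearly with the parameter:
    [|s_t - x| <= (t / r) |s_r - x|] with [t / r = 1 + 2 t mu]
    ([prox_linear_step_scaling]).

    The minimisers exist because a closed function is bounded below near each
    point of its domain and strong convexity propagates such a bound along rays,
    with quadratic growth ([strongly_convex_argmin]). *)

(** * The Euclidean norm on row vectors *)

Definition dotv {R : realType} {n : nat} (u v : 'rV[R]_n) : R :=
  \sum_(i < n) u 0 i * v 0 i.

Lemma l2norm_ge0 (R : realType) n (v : 'rV[R]_n) : 0 <= l2norm v.
Proof. exact: sqrtr_ge0. Qed.

Lemma sqr_l2norm (R : realType) n (v : 'rV[R]_n) :
  l2norm v ^+ 2 = \sum_(i < n) v 0 i ^+ 2.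
Proof. by rewrite sqr_sqrtr// sumr_ge0// => i _; rewrite sqr_ge0. Qed.

Lemma dotvv (R : realType) n (v : 'rV[R]_n) : dotv v v = l2norm v ^+ 2.
Proof. by rewrite sqr_l2norm; apply: eq_bigr => i _; rewrite expr2. Qed.

Lemma l2norm0 (R : realType) n : l2norm (0 : 'rV[R]_n) = 0.
Proof.
by rewrite /l2norm big1 ?sqrtr0// => i _; rewrite mxE expr0n.
Qed.

Lemma l2normZ (R : realType) n (a : R) (v : 'rV[R]_n) :
  l2norm (a *: v) = `|a| * l2norm v.
Proof.
rewrite /l2norm -sqrtr_sqr -sqrtrM ?sqr_ge0// mulr_sumr.
by congr Num.sqrt; apply: eq_bigr => i _; rewrite mxE exprMn.
Qed.

Lemma l2normC (R : realType) n (u v : 'rV[R]_n) :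
  l2norm (u - v) = l2norm (v - u).
Proof. by rewrite -opprB -scaleN1r l2normZ normrN1 mul1r. Qed.

Lemma dotvZr (R : realType) n (a : R) (u v : 'rV[R]_n) :
  dotv u (a *: v) = a * dotv u v.
Proof. by rewrite mulr_sumr; apply: eq_bigr => i _; rewrite mxE mulrCA. Qed.

Lemma dotvDr (R : realType) n (u v w : 'rV[R]_n) :
  dotv u (v + w) = dotv u v + dotv u w.
Proof. by rewrite -big_split/=; apply: eq_bigr => i _; rewrite mxE mulrDr. Qed.

Lemma sqr_l2normDZ (R : realType) n (a : R) (u v : 'rV[R]_n) :
  l2norm (u + a *: v) ^+ 2 =
  l2norm u ^+ 2 + 2 * a * dotv u v + a ^+ 2 * l2norm v ^+ 2.
Proof.
rewrite !sqr_l2norm /dotv !mulr_sumr -!big_split/=.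
by apply: eq_bigr => i _; rewrite !mxE; ring.
Qed.

Lemma dotv_le (R : realType) n (u v : 'rV[R]_n) :
  dotv u v <= l2norm u * l2norm v.
Proof.
have [v0|v0] := eqVneq (l2norm v) 0.
  rewrite v0 mulr0 le_eqVlt; apply/orP; left; apply/eqP.
  rewrite /dotv big1// => i _.
  have : \sum_(j < n) v 0 j ^+ 2 == 0 by rewrite -sqr_l2norm v0 expr0n.
  rewrite psumr_eq0 => [/allP/(_ i)|j _]; last exact: sqr_ge0.
  by rewrite mem_index_enum sqrf_eq0 => /(_ isT)/eqP ->; rewrite mulr0.
have vp : 0 < l2norm v by rewrite lt_neqAle eq_sym v0 l2norm_ge0.
(* [u - s v] is shortest for [s = <u, v> / |v|^2] *)
have := sqr_ge0 (l2norm (u + (- (dotv u v / l2norm v ^+ 2)) *: v)).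
rewrite sqr_l2normDZ.
rewrite [X in 0 <= X -> _](_ : _ =
  ((l2norm u * l2norm v) ^+ 2 - dotv u v ^+ 2) / l2norm v ^+ 2); last by field.
rewrite pmulr_lge0 ?invr_gt0 ?exprn_gt0// subr_ge0 => H.
have [d0|d0] := leP (dotv u v) 0.
  by rewrite (le_trans d0)// mulr_ge0 ?l2norm_ge0.
by rewrite -(@ler_pXn2r _ 2%N)// ?nnegrE ?mulr_ge0 ?l2norm_ge0// ltW.
Qed.

Lemma l2norm_triangle (R : realType) n (u v : 'rV[R]_n) :
  l2norm (u + v) <= l2norm u + l2norm v.
Proof.
rewrite -(@ler_pXn2r _ 2%N)// ?nnegrE ?addr_ge0 ?l2norm_ge0//.
rewrite -[v]scale1r sqr_l2normDZ scale1r.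
by have := dotv_le u v; nra.
Qed.

Lemma l2norm_le_norm (R : realType) n (v : 'rV[R]_n) :
  l2norm v <= n%:R * `|v|.
Proof.
rewrite -(@ler_pXn2r _ 2%N)// ?nnegrE ?mulr_ge0 ?l2norm_ge0//.
rewrite sqr_l2norm; apply: (@le_trans _ _ (\sum_(i < n) `|v| ^+ 2)).
  apply: ler_sum => i _; rewrite -real_normK ?num_real//.
  rewrite ler_pXn2r// ?nnegrE//.
  rewrite [leRHS]/Num.norm/= mx_normrE; apply/bigmax_geP; right => /=.
  by exists (0, i).
rewrite sumr_const card_ord exprMn -[leLHS]mulr_natl ler_wpM2r ?sqr_ge0//.
by rewrite -natrX ler_nat; case: (n) => // k; rewrite leq_pmulr.
Qed.

Lemma norm_le_l2norm (R : realType) n (v : 'rV[R]_n) : `|v| <= l2norm v.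
Proof.
rewrite [leLHS]/Num.norm/= mx_normrE; apply/bigmax_leP; split=> [|[i j] _ /=].
  exact: l2norm_ge0.
rewrite ord1 -sqrtr_sqr ler_wsqrtr// (bigD1 j)//= lerDl.
by rewrite sumr_ge0// => k _; rewrite sqr_ge0.
Qed.

Lemma l2lipschitz_continuous (R : realType) n (K : R) (f : 'rV[R]_n -> R) :
  l2lipschitz K f -> continuous (f : 'rV[R]_n -> R^o).
Proof.
move=> fK x; have Kn0 : 0 < `|K| * n%:R + 1 by rewrite ltr_wpDl// mulr_ge0.
apply/(@cvgrPdist_lt R R^o 'rV[R]_n (nbhs x) _ f (f x)) => e e0.
apply/nbhs_ballP; exists (e / (`|K| * n%:R + 1)); first by rewrite /= divr_gt0.
move=> y; rewrite -ball_normE /ball_/= ltr_pdivlMr// mulrC => yx.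
rewrite (le_lt_trans (fK _ _))// (le_lt_trans _ yx)//.
rewrite (le_trans (ler_wpM2r (l2norm_ge0 _) (ler_norm K)))//.
rewrite mulrDl -mulrA ler_wpDr ?mul1r// ler_wpM2l//.
exact: l2norm_le_norm.
Qed.

Lemma l2dist_continuous (R : realType) n (y : 'rV[R]_n) :
  continuous (fun z : 'rV[R]_n => l2norm (z - y) : R^o).
Proof.
apply: (@l2lipschitz_continuous _ _ 1) => u v.
have := l2norm_triangle (u - v) (v - y); have := l2norm_triangle (v - u) (u - y).
by rewrite !addrA !subrK (l2normC v u) mul1r ler_norml => ? ?; lra.
Qed.

Lemma ler_sqrtM (R : realType) (a u v : R) : 0 <= a -> 0 <= u -> 0 <= v ->
  u ^+ 2 <= a * v ^+ 2 -> u <= Num.sqrt a * v.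
Proof.
move=> a0 u0 v0 H; rewrite -(@ler_pXn2r _ 2%N)// ?nnegrE ?mulr_ge0 ?sqrtr_ge0//.
by rewrite exprMn sqr_sqrtr.
Qed.

(** * Strong convexity *)

(** A negative [sigma] expresses weak convexity with constant [- sigma]. *)
Definition strongly_convex {R : realType} {n : nat} (sigma : R)
    (q : 'rV[R]_n -> R) :=
  forall (u v : 'rV[R]_n) (s : R), 0 <= s <= 1 ->
    q ((1 - s) *: u + s *: v) <=
    (1 - s) * q u + s * q v - sigma / 2 * (s * (1 - s)) * l2norm (u - v) ^+ 2.

(** The values of [f] enter through real upper bounds [a] and [b], so that the
    convex combination never involves infinite values. *)
Definition strongly_convex_efun {R : realType} {n : nat} (sigma : R)
    (f : 'rV[R]_n -> \bar R) :=
  forall (u v : 'rV[R]_n) (a b s : R), 0 <= s <= 1 ->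
    (f u <= a%:E)%E -> (f v <= b%:E)%E ->
    (f ((1 - s) *: u + s *: v)%R <=
      ((1 - s) * a + s * b
        - sigma / 2 * (s * (1 - s)) * l2norm (u - v) ^+ 2)%R%:E)%E.

Lemma convex_function_strongly_convex (R : realType) n (h : 'rV[R]_n -> R) :
  convex_function [set: 'rV[R]_n] h -> strongly_convex 0 h.
Proof.
move=> hc u v s s01; rewrite !mul0r subr0.
have s01' : 0 <= 1 - s <= 1 by lra.
have /andP[t0 t1] := s01'.
have := hc (Itv01 t0 t1) u v (in_setT _) (in_setT _).
have -> : conv (Itv01 t0 t1) (u : convex_lmodType 'rV[R]_n) v = (1 - s) *: u + s *: v.
  by rewrite /conv/= /unstable.onem subKr.
by rewrite convRE/= /unstable.onem subKr.
Qed.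

Lemma convex_efun_strongly_convex (R : realType) n (g : 'rV[R]_n -> \bar R) :
  convex_efun g -> strongly_convex_efun 0 g.
Proof.
move=> gc u v a b s s01 ua vb; rewrite !mul0r subr0.
have s01' : 0 <= 1 - s <= 1 by lra.
have /andP[t0 t1] := s01'.
have := gc (u, a) (v, b) (Itv01 t0 t1).
rewrite !in_setE => /(_ ua vb).
by rewrite /epigraph/= /conv/= /unstable.onem subKr.
Qed.

Lemma strongly_convexD (R : realType) n (sigma tau : R) (p q : 'rV[R]_n -> R) :
  strongly_convex sigma p -> strongly_convex tau q ->
  strongly_convex (sigma + tau) (fun z => p z + q z).
Proof.
by move=> sp sq u v s s01; have := sp u v s s01; have := sq u v s s01; lra.
Qed.

Lemma strongly_convex_efunD (R : realType) n (sigma : R)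
    (g : 'rV[R]_n -> \bar R) (q : 'rV[R]_n -> R) :
  convex_efun g -> strongly_convex sigma q ->
  strongly_convex_efun sigma (fun z => g z + (q z)%:E)%E.
Proof.
move=> /convex_efun_strongly_convex sg sq u v a b s s01.
rewrite -!leeBrDr// -!EFinB => ua vb.
apply: (le_trans (sg _ _ _ _ _ s01 ua vb)).
by rewrite lee_fin; have := sq u v s s01; lra.
Qed.

Lemma sqr_l2norm_conv (R : realType) n (u v y : 'rV[R]_n) (s : R) :
  l2norm ((1 - s) *: u + s *: v - y) ^+ 2 =
  (1 - s) * l2norm (u - y) ^+ 2 + s * l2norm (v - y) ^+ 2
  - s * (1 - s) * l2norm (u - v) ^+ 2.
Proof.
rewrite !sqr_l2norm !mulr_sumr -sumrN -!big_split/=.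
by apply: eq_bigr => i _; rewrite !mxE; ring.
Qed.

Lemma strongly_convex_sqr_l2norm (R : realType) n (k : R) (y : 'rV[R]_n) :
  strongly_convex (2 * k) (fun z => k * l2norm (z - y) ^+ 2).
Proof.
move=> u v s _; rewrite sqr_l2norm_conv le_eqVlt; apply/orP; left; apply/eqP.
by field.
Qed.

(** With [a = c y] and [A] the Jacobian of [c] at [y], this is the convexity of
    the model that the prox-linear step minimises. *)
Lemma strongly_convex_comp_affine (R : realType) d m (h : 'rV[R]_m -> R)
    (a : 'rV[R]_m) (y : 'rV[R]_d) (A : 'M[R]_(d, m)) :
  strongly_convex 0 h -> strongly_convex 0 (fun z => h (a + (z - y) *m A)).
Proof.
move=> hc u v s s01; rewrite !mul0r subr0.
have := hc (a + (u - y) *m A) (a + (v - y) *m A) s s01.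
rewrite !mul0r subr0; congr (h _ <= _).
rewrite !mulmxBl mulmxDl -!scalemxAl.
move: (u *m A) (v *m A) (y *m A) => u' v' y'.
by apply/rowP => i; rewrite !mxE; ring.
Qed.

(** At a convex combination [y] of [u] and [v], convexity of the model [ell y]
    bounds [q y = ell y y] by the values of the model at [u] and [v]; the model
    errors there, weighted, add up to [mu / 2 * (s * (1 - s)) * |u - v|^2] by
    [sqr_l2norm_conv]. *)
Lemma weakly_convex_of_models (R : realType) n (mu : R) (q : 'rV[R]_n -> R)
    (ell : 'rV[R]_n -> 'rV[R]_n -> R) :
  (forall y, ell y y = q y) -> (forall y, strongly_convex 0 (ell y)) ->
  (forall y z, ell y z <= q z + mu / 2 * l2norm (z - y) ^+ 2) ->
  strongly_convex (- mu) q.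
Proof.
move=> ellE ellc ell_le u v s s01; set y := _ + _.
have := ellc y u v s s01; rewrite -/y ellE !mul0r subr0.
have := sqr_l2norm_conv u v y s; rewrite -/y subrr l2norm0.
have := ell_le y u; have := ell_le y v; have /andP[s0 s1] := s01.
move: (l2norm (u - v) ^+ 2) (l2norm (u - y) ^+ 2) (l2norm (v - y) ^+ 2) => a b e.
move=> hv hu h0 H.
have : s * ell y v <= s * (q v + mu / 2 * e) by rewrite ler_wpM2l.
have : (1 - s) * ell y u <= (1 - s) * (q u + mu / 2 * b).
  by rewrite ler_wpM2l// subr_ge0.
have -> : - mu / 2 * (s * (1 - s)) * a = - mu / 2 * (s * (1 - s) * a) by ring.
have -> : s * (1 - s) * a = (1 - s) * b + s * e by rewrite expr0n/= in h0; lra.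
by nra.
Qed.

(** Quadratic growth: compare the minimum with its value at the points
    [(1 - s) z0 + s w] and let [s] tend to [0]. *)
Lemma argmin_growth (R : realType) n (sigma : R) (f : 'rV[R]_n -> \bar R)
    (z0 w : 'rV[R]_n) (r b : R) :
  0 < sigma -> strongly_convex_efun sigma f -> argmin f z0 -> f z0 = r%:E ->
  (f w <= b%:E)%E -> r + sigma / 2 * l2norm (w - z0) ^+ 2 <= b.
Proof.
move=> s0 sf z0min fz0 fw; set D := l2norm _ ^+ 2.
have D0 : 0 <= D by exact: sqr_ge0.
have key s : 0 < s -> s <= 1 -> sigma / 2 * (1 - s) * D <= b - r.
  move=> sp s1; have s01 : 0 <= s <= 1 by rewrite ltW.
  have fz0r : (f z0 <= r%:E)%E by rewrite fz0.
  have := le_trans (z0min _) (sf _ _ _ _ _ s01 fz0r fw).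
  rewrite fz0 lee_fin l2normC -/D => H.
  rewrite -(ler_pM2l sp); lra.
apply/ler_addgt0Pr => e e0.
(* [s] is small enough for the loss [k * s] not to exceed [e] *)
pose k := sigma / 2 * D; have k0 : 0 <= k by rewrite mulr_ge0// divr_ge0// ltW.
pose s := e / (e + k); have ek0 : 0 < e + k by rewrite ltr_wpDr.
have sp : 0 < s by rewrite divr_gt0.
have s1 : s <= 1 by rewrite ler_pdivrMr// mul1r lerDl.
have := key s sp s1; rewrite mulrAC -/k mulrBr mulr1.
have : k * s <= e.
  by rewrite mulrCA ger_pMr// ler_pdivrMr// mul1r lerDr ltW.
lra.
Qed.

(** * Minimisers of strongly convex functions *)

(** As [(x0, f x0 - 1)] is outside the closed epigraph, [f x0 - 1] bounds
    [f] below near [x0]; strong convexity along rays from [x0] propagates this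
    to a lower bound of quadratic growth on the whole space. The part of the
    epigraph below [f x0] is thus compact, and its lowest point is a
    minimiser. *)
Lemma strongly_convex_argmin (R : realType) n (sigma : R)
    (f : 'rV[R]_n -> \bar R) :
  0 < sigma -> proper_fun f -> closed_fun f -> strongly_convex_efun sigma f ->
  argmin f !=set0.
Proof.
move=> s0 [fNy [x0 fx0y]] fcl fsc.
have [r0 fx0] : exists r0, f x0 = r0%:E.
  by have := fNy x0; case: (f x0) fx0y => // r _ _; exists r.
have fx0le : (f x0 <= r0%:E)%E by rewrite fx0.
have [dlt dlt0 fnear] : exists2 dlt : R, 0 < dlt &
    forall z b, l2norm (z - x0) <= dlt -> (f z <= b%:E)%E -> r0 - 1 <= b.
  have : nbhs ((x0, r0 - 1) : 'rV[R]_n * R^o) (~` epigraph f).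
    apply: open_nbhs_nbhs; split; first exact: closed_openC.
    by rewrite /epigraph/= fx0 lee_fin; apply/negP; rewrite -ltNge; lra.
  move=> /nbhs_ballP[e /= e0 He]; exists (e / 2); first by rewrite divr_gt0.
  move=> z b zx fz; rewrite leNgt; apply/negP => br.
  apply: (He (z, r0 - 1)).
    split=> /=; last exact: ballxx.
    rewrite -ball_normE /ball_/= (le_lt_trans (norm_le_l2norm _))// l2normC.
    by rewrite (le_lt_trans zx)// ltr_pdivrMr// ltr_pMr// ltr1n.
  by rewrite /epigraph/= (le_trans fz)// lee_fin ltW.
have ffar z b : dlt <= l2norm (z - x0) -> (f z <= b%:E)%E ->
    r0 - l2norm (z - x0) / dlt
      + sigma / 2 * (l2norm (z - x0) - dlt) * l2norm (z - x0) <= b.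
  set rho := l2norm _ => rd fz; have rho0 : 0 < rho by exact: lt_le_trans rd.
  (* the point of the segment from [x0] to [z] at distance [dlt] from [x0] *)
  pose s := dlt / rho.
  have sp : 0 < s by rewrite divr_gt0.
  have s01 : 0 <= s <= 1 by rewrite (ltW sp)/= ler_pdivrMr// mul1r.
  have := fsc x0 z r0 b s s01 fx0le fz.
  move=> /fnear; rewrite (_ : _ - x0 = s *: (z - x0)); last first.
    by apply/rowP => i; rewrite !mxE; ring.
  rewrite l2normZ gtr0_norm// -/rho mulfVK ?gt_eqF// lexx => /(_ isT).
  rewrite l2normC -/rho => H.
  have sE : dlt = s * rho by rewrite mulfVK ?gt_eqF.
  have -> : rho / dlt = s^-1 by rewrite invf_div.
  rewrite -(ler_pM2l sp) mulrDr mulrBr divff ?gt_eqF// sE; lra.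
(* beyond the distance [M] the lower bound [ffar] exceeds [r0] *)
pose M := dlt + 2 / (dlt * sigma).
have M0 : 0 < 2 / (dlt * sigma) by rewrite divr_gt0// mulr_gt0.
have Mlow z b : (f z <= b%:E)%E -> b <= r0 ->
    l2norm (z - x0) <= M /\ r0 - M / dlt <= b.
  move=> fz br; have [zd|zd] := leP (l2norm (z - x0)) dlt.
    split; first by rewrite (le_trans zd)// lerDl ltW.
    rewrite (le_trans _ (fnear _ _ zd fz))// lerD2l lerN2 ler_pdivlMr// mul1r.
    by rewrite lerDl ltW.
  have := ffar _ _ (ltW zd) fz; set rho := l2norm _ in zd *; move=> H.
  have rho0 : 0 < rho by exact: lt_trans zd.
  have rM : rho <= M.
    have : 0 <= rho * (dlt^-1 - sigma / 2 * (rho - dlt)) by lra.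
    rewrite pmulr_rge0// subr_ge0 => H2.
    rewrite -lerBlDl -(ler_pM2l (_ : 0 < sigma / 2)) ?divr_gt0//.
    rewrite (le_trans H2)// le_eqVlt; apply/orP; left; apply/eqP; field.
    by rewrite !gt_eqF.
  split=> //; apply: le_trans H.
  have : rho / dlt <= M / dlt by rewrite ler_pM2r// invr_gt0.
  have : 0 <= sigma / 2 * (rho - dlt) * rho.
    by rewrite !mulr_ge0// ?subr_ge0 ?invr_ge0 ltW.
  lra.
pose B := [set z : 'rV[R]_n | l2norm (z - x0) <= M].
have Bcompact : compact B.
  apply: bounded_closed_compact.
    exists (M + `|x0|); split; first exact: num_real.
    move=> y My z Bz; apply/ltW; apply: le_lt_trans My.
    rewrite -{1}(subrK x0 z) (le_trans (ler_normD _ _))// lerD2r.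
    by rewrite (le_trans (norm_le_l2norm _)).
  rewrite (_ : B = (fun z => l2norm (z - x0)) @^-1` [set y : R^o | y <= M]) //.
  apply: preimage_closed; last exact: (@closed_le R).
  by move=> z _; exact: l2dist_continuous.
have Kcompact : compact ((B `*` `[r0 - M / dlt, r0]%classic) `&` epigraph f).
  apply: compact_closedI => //; apply: compact_setX => //.
  exact: segment_compact.
have Kx0 : ((B `*` `[r0 - M / dlt, r0]%classic) `&` epigraph f) (x0, r0).
  have [? ?] := Mlow x0 r0 fx0le (lexx _).
  by split=> //; split=> //=; rewrite in_itv/= lexx andbT.
have [|c cK cmin] := @compact_EVT_min _ R (fun p : 'rV[R]_n * R^o => p.2)
    _ (ex_intro _ _ Kx0) Kcompact.
  by apply: continuous_subspaceT => p; exact: cvg_snd.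
move: cK; rewrite inE => -[[_ /=]]; rewrite in_itv/= => /andP[_ cr0] fc.
exists c.1 => w; case fw : (f w) => [b||]; [|by rewrite leey|by have := fNy w; rewrite fw].
apply: (le_trans fc); rewrite lee_fin.
have [br0|/ltW] := leP b r0; last exact: le_trans.
have fwb : (f w <= b%:E)%E by rewrite fw.
have [? ?] := Mlow w b fwb br0.
apply: (cmin (w, b)); rewrite inE; split=> //; split=> //=.
by rewrite in_itv/= br0 andbT.
Qed.

(** * The gradient of the Moreau envelope *)

Lemma dotv_lipschitz (R : realType) n (a : 'rV[R]_n) :
  l2lipschitz (l2norm a) (dotv a).
Proof.
move=> u v; rewrite -mulN1r -dotvZr -dotvDr scaleN1r ler_norml dotv_le andbT.
rewrite lerNl -mulN1r -dotvZr (le_trans (dotv_le _ _))//.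
by rewrite l2normZ normrN1 mul1r.
Qed.

Lemma dotv_is_linear (R : realType) n (a : 'rV[R]_n) :
  linear (dotv a : 'rV[R]_n -> R^o).
Proof. by move=> k u v; rewrite dotvDr dotvZr. Qed.

HB.instance Definition _ (R : realType) n (a : 'rV[R]_n) :=
  GRing.isLinear.Build R 'rV[R]_n R^o _ (dotv a : 'rV[R]_n -> R^o)
    (dotv_is_linear a).

Lemma differentiable_dotv (R : realType) n (a u : 'rV[R]_n) :
  differentiable (dotv a : 'rV[R]_n -> R^o) u.
Proof.
apply: linear_differentiable.
exact: l2lipschitz_continuous (dotv_lipschitz a).
Qed.

Lemma diff_dotv (R : realType) n (a u : 'rV[R]_n) :
  'd (dotv a : 'rV[R]_n -> R^o) u = dotv a :> ('rV[R]_n -> R^o).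
Proof.
apply: diff_lin.
exact: l2lipschitz_continuous (dotv_lipschitz a).
Qed.

(** A remainder quadratic in the Euclidean norm is negligible for the sup norm
    too, the two norms being equivalent. *)
Lemma gradient_of_quadratic_error (R : realType) n (f : 'rV[R]_n -> R^o)
    (x a : 'rV[R]_n) (C : R) : 0 <= C ->
  (forall q, `|f (q + x) - (f x + dotv a q)| <= C * l2norm q ^+ 2) ->
  gradient f x = a.
Proof.
move=> C0 fC.
have df : 'd f x = dotv a :> ('rV[R]_n -> R^o).
  apply: (@diff_unique R 'rV[R]_n R^o f (dotv a : 'rV[R]_n -> R^o)).
    exact: l2lipschitz_continuous (dotv_lipschitz a).
  apply/eqaddoP => _/posnumP[e]; apply/nbhs_ballP.
  have D0 : 0 < C * n%:R ^+ 2 + 1 by rewrite ltr_wpDl// mulr_ge0// sqr_ge0.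
  exists (e%:num / (C * n%:R ^+ 2 + 1)); first by rewrite /= divr_gt0.
  move=> q; rewrite -ball_normE /ball_/= sub0r normrN ltr_pdivlMr// => qe.
  apply: (le_trans (fC q)).
  apply: (@le_trans _ _ (C * (n%:R * `|q|) ^+ 2)).
    rewrite ler_wpM2l// ler_pXn2r ?nnegrE ?mulr_ge0 ?l2norm_ge0//.
    exact: l2norm_le_norm.
  rewrite exprMn mulrA expr2 mulrA ler_wpM2r//.
  by rewrite (le_trans _ (ltW qe))// mulrC ler_wpM2l// lerDl.
apply/rowP => i; rewrite mxE df /dotv (bigD1 i)//= big1 => [|j ji].
  by rewrite mxE !eqxx mulr1 addr0.
by rewrite mxE (negbTE ji) andbF mulr0.
Qed.

(** Quadratic growth at the minimiser [z0] of [f + |. - x|^2 / (2 nu)] pins the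
    envelope near [x] between two quadratics with the same value and slope at
    [x]: the upper one keeps the competitor [z0], the lower one absorbs the
    displacement of the minimiser into the growth term. *)
Lemma grad_moreau_prox (R : realType) n (nu sigma r : R)
    (f : 'rV[R]_n -> \bar R) (x z0 : 'rV[R]_n) :
  0 < nu -> 0 < sigma -> (forall z, f z != -oo%E) -> f z0 = r%:E ->
  (forall w b, (f w <= b%:E)%E ->
    r + 1 / (2 * nu) * l2norm (z0 - x) ^+ 2 + sigma / 2 * l2norm (w - z0) ^+ 2
    <= b + 1 / (2 * nu) * l2norm (w - x) ^+ 2) ->
  grad_moreau nu f x = nu^-1 *: (x - z0).
Proof.
move=> nu0 s0 fNy fz0 growth; set k := 1 / (2 * nu) in growth.
have k0 : 0 < k by rewrite divr_gt0// mulr_gt0.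
set a := nu^-1 *: (x - z0).
set E0 := r + k * l2norm (z0 - x) ^+ 2.
have upper q : (moreau_envelope nu f (q + x) <=
    (E0 + dotv a q + k * l2norm q ^+ 2)%:E)%E.
  apply: ereal_inf_lbound; exists z0 => //; rewrite fz0 -EFinD; congr (_%:E).
  rewrite -/k /E0 -!addrA; congr (_ + _).
  rewrite /dotv !sqr_l2norm !mulr_sumr -!big_split/=; apply: eq_bigr => i _.
  by rewrite /k !mxE; field; rewrite gt_eqF.
pose C := k + 2 * k ^+ 2 / sigma.
have C0 : 0 <= C.
  apply: addr_ge0; first exact: ltW.
  by rewrite divr_ge0 ?(ltW s0)// mulr_ge0 ?sqr_ge0.
have lower q : ((E0 + dotv a q - C * l2norm q ^+ 2)%:E <=
    moreau_envelope nu f (q + x))%E.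
  apply/ereal_infP => _ [w _ <-].
  case fw : (f w) => [b||]; last by have := fNy w; rewrite fw.
    2: by rewrite addye// leey.
  rewrite -EFinD lee_fin -/k.
  have fwb : (f w <= b%:E)%E by rewrite fw.
  have := growth w b fwb; rewrite -/E0 => H.
  (* complete the square in [w - z0] *)
  have := sqr_ge0 (l2norm (w - z0 + (- (2 * k / sigma)) *: q)).
  rewrite sqr_l2normDZ => /(@mulr_ge0 _ (sigma / 2) _); rewrite divr_ge0 ?(ltW s0)//.
  move=> /(_ isT) H2.
  have E : k * l2norm (w - (q + x)) ^+ 2 =
      k * l2norm (w - x) ^+ 2 + dotv a q - 2 * k * dotv (w - z0) q
      + k * l2norm q ^+ 2.
    rewrite /dotv !sqr_l2norm !mulr_sumr -sumrN -!big_split/=.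
    by apply: eq_bigr => i _; rewrite /k !mxE; field; rewrite gt_eqF.
  have H3 : sigma / 2 * (l2norm (w - z0) ^+ 2
      + 2 * - (2 * k / sigma) * dotv (w - z0) q
      + (- (2 * k / sigma)) ^+ 2 * l2norm q ^+ 2) =
      sigma / 2 * l2norm (w - z0) ^+ 2 - 2 * k * dotv (w - z0) q
      + 2 * k ^+ 2 / sigma * l2norm q ^+ 2.
    by field; rewrite gt_eqF.
  rewrite H3 in H2; rewrite E /C.
  have : 0 <= k * l2norm q ^+ 2 by rewrite mulr_ge0 ?sqr_ge0 ?(ltW k0).
  move: H H2; lra.
have fin_env q : moreau_envelope nu f (q + x) \is a fin_num.
  by rewrite fin_numElt (lt_le_trans _ (lower q)) ?ltNyr// (le_lt_trans (upper q)) ?ltry.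
have E0E : fine (moreau_envelope nu f x) = E0.
  have := upper 0; have := lower 0; have := fin_env 0.
  rewrite add0r => /fineK <-; rewrite !lee_fin l2norm0 expr0n/= !mulr0.
  have -> : dotv a 0 = 0 by rewrite -(scale0r x) dotvZr mul0r.
  by lra.
apply: (@gradient_of_quadratic_error _ _ _ _ _ C) => // q; rewrite E0E.
have := upper q; have := lower q; rewrite -(fineK (fin_env q)) !lee_fin.
have : 0 <= 2 * k ^+ 2 / sigma * l2norm q ^+ 2.
  by rewrite mulr_ge0 ?sqr_ge0// divr_ge0 ?(ltW s0)// mulr_ge0 ?sqr_ge0.
by rewrite ler_norml /C => ? ? ?; lra.
Qed.

(** * Linearisation error *)

(** The supremum defining [opnorm] is a genuine one: on the unit ball
    [v *m A] is bounded by the sum of the norms of the rows of [A]. *)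
Lemma l2norm_mulmx_le_opnorm (R : realType) d m (A : 'M[R]_(d, m))
    (v : 'rV[R]_d) : l2norm (v *m A) <= opnorm A * l2norm v.
Proof.
have [C HC] : exists C, forall u : 'rV[R]_d, l2norm u <= 1 -> l2norm (u *m A) <= C.
  exists (\sum_i l2norm (row i A)) => u u1; rewrite mulmx_sum_row.
  apply: (@le_trans _ _ (\sum_i l2norm (u 0 i *: row i A))).
    elim/big_ind2 : _ => [|x1 y1 x2 y2 h1 h2|//]; first by rewrite l2norm0.
    by rewrite (le_trans (l2norm_triangle _ _))// lerD.
  apply: ler_sum => i _; rewrite l2normZ ler_piMl ?l2norm_ge0//.
  rewrite (le_trans _ u1)// (le_trans _ (norm_le_l2norm u))//.
  rewrite [leRHS]/Num.norm/= mx_normrE; apply/bigmax_geP; right => /=.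
  by exists (0, i).
have ub u : l2norm u <= 1 -> l2norm (u *m A) <= opnorm A.
  move=> u1; apply: sup_upper_bound; last by exists u.
  split; first by exists (l2norm (0 *m A)), 0; rewrite //= l2norm0 ler01.
  by exists C => _ [w w1 <-]; exact: HC.
have := l2norm_ge0 v; rewrite le_eqVlt => /orP[/eqP v0|v0].
  have -> : v = 0.
    by apply/eqP; rewrite -normr_le0 (le_trans (norm_le_l2norm _))// -v0.
  by rewrite mul0mx !l2norm0 mulr0.
have := ub ((l2norm v)^-1 *: v).
rewrite -scalemxAl !l2normZ gtr0_norm ?invr_gt0// mulVf ?gt_eqF// lexx.
by move=> /(_ isT); rewrite ler_pdivrMl// mulrC.
Qed.

Lemma is_derive_along_line (R : realType) (V W : normedModType R) (f : V -> W)
    (y v : V) (s : R) : differentiable f (y + s *: v) ->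
  is_derive (s : R^o) 1 (fun r : R^o => f (y + r *: v)) ('d f (y + s *: v) v).
Proof.
move=> df.
have dl : is_diff (s : R^o) (fun r : R^o => y + r *: v) ( *:%R ^~ v).
  apply: (is_diff_eq (is_diffD (is_diff_cst y (s : R^o)) (is_diff_scalel s v))).
  by rewrite add0r.
have dc := is_diff_comp dl (differentiableP df).
apply: DeriveDef; first by apply/derivable1_diffP; exact: (@ex_diff _ _ _ _ _ _ _ dc).
rewrite deriveE; last exact: (@ex_diff _ _ _ _ _ _ _ dc).
by rewrite (@diff_val _ _ _ _ _ _ _ dc)/= scale1r.
Qed.

Lemma is_derive_dotv_along_line (R : realType) d m (c : 'rV[R]_d -> 'rV[R]_m)
    (w : 'rV[R]_m) (y v : 'rV[R]_d) (s : R) : differentiable c (y + s *: v) ->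
  is_derive (s : R^o) 1 (fun r : R^o => dotv w (c (y + r *: v)) : R^o)
    (dotv w (v *m jacobian c (y + s *: v))).
Proof.
move=> dc.
have dwc := differentiable_comp dc (differentiable_dotv w (c (y + s *: v))).
have := @is_derive_along_line R 'rV[R]_d R^o ((dotv w : 'rV[R]_m -> R^o) \o c) y v s dwc.
rewrite (diff_comp dc (differentiable_dotv w _)).
rewrite [X in X -> _]/=.
rewrite diff_dotv.
by rewrite /jacobian mul_rV_lin1.
Qed.

Lemma ler_increment_derive_affine (R : realType) (phi dphi : R -> R) (A K : R) :
  (forall s : R, is_derive s 1 phi (dphi s)) ->
  (forall s, 0 <= s -> dphi s <= A + K * s) ->
  phi 1 - phi 0 <= A + K / 2.
Proof.
move=> phid dphi_le.
pose psi := phi - (A *: (id : R -> R) + (K / 2) *: ((id : R -> R) ^+ 2)).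
have psid (s : R) : is_derive s 1 psi (dphi s - (A + K * s)).
  have d1 := is_deriveZ (A : R) (is_derive_id (s : R^o) (1 : R^o)).
  have d2 := is_deriveZ (K / 2) (@is_deriveX R R^o id 2 s 1 1 (is_derive_id (s : R^o) (1 : R^o))).
  have d3 := is_deriveB (phid s) (is_deriveD d1 d2).
  apply: (is_derive_eq d3); rewrite /GRing.scale/= expr1 !mulr1; lra.
have : psi 1 <= psi 0.
  apply: (@ler0_derive1_le_cc R psi 0 1); rewrite ?in_itv/= ?lexx ?ler01//.
  - by move=> u; rewrite in_itv/= => /andP[/ltW u0 _]; rewrite derive1E derive_val subr_le0 dphi_le.
  - apply: derivable_within_continuous => u _; exact: ex_derive.
rewrite /psi !fctE /GRing.scale/= expr1n expr0n/= => H; lra.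
Qed.

(** Test the error against [w], the error vector itself, and integrate along
    the segment: [s |-> <w, c (y + s v)>] has a derivative exceeding its value
    at [s = 0] by at most [|w| beta s |v|^2]. *)
Lemma linearization_error (R : realType) d m (c : 'rV[R]_d -> 'rV[R]_m)
    (beta : R) (y z : 'rV[R]_d) :
  0 <= beta -> (forall x, differentiable c x) ->
  (forall u v, opnorm (jacobian c u - jacobian c v) <= beta * l2norm (u - v)) ->
  l2norm (c z - (c y + (z - y) *m jacobian c y)) <=
  beta / 2 * l2norm (z - y) ^+ 2.
Proof.
move=> beta0 cdiff clip; set v := z - y.
have [w wE] : exists w, w = c z - (c y + v *m jacobian c y) by eexists.
rewrite -wE.
have := @ler_increment_derive_affine R (fun s => dotv w (c (y + s *: v)))
  (fun s => dotv w (v *m jacobian c (y + s *: v)))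
  (dotv w (v *m jacobian c y)) (l2norm w * (beta * l2norm v ^+ 2))
  (fun s => is_derive_dotv_along_line w (cdiff _)).
have yv : y + v = z by rewrite addrC subrK.
rewrite scale1r scale0r addr0 yv => phi_le.
have {phi_le} : dotv w (c z) - dotv w (c y) <=
    dotv w (v *m jacobian c y) + l2norm w * (beta * l2norm v ^+ 2) / 2.
  apply: phi_le => s s0; rewrite -lerBlDl.
  rewrite -mulN1r -dotvZr -dotvDr scaleN1r -mulmxBr (le_trans (dotv_le _ _))//.
  rewrite -mulrA ler_wpM2l ?l2norm_ge0//.
  apply: (le_trans (l2norm_mulmx_le_opnorm _ _)).
  have := clip (y + s *: v) y.
  have -> : y + s *: v - y = s *: v by rewrite addrC addKr.
  rewrite l2normZ ger0_norm//.
  move: (opnorm _) (l2norm v) (l2norm_ge0 v) => o r r0 /(ler_wpM2r r0).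
  by move=> /le_trans -> //; rewrite le_eqVlt; apply/orP; left; apply/eqP; ring.
have cz : c z = w + (c y + v *m jacobian c y) by rewrite wE subrK.
rewrite {1}cz !dotvDr dotvv; clear wE yv cz => H.
have := l2norm_ge0 w; rewrite le_eqVlt => /orP[/eqP w0|w0].
  by rewrite -w0 mulr_ge0 ?sqr_ge0// divr_ge0.
rewrite -(ler_pM2l w0); lra.
Qed.

(** * Proximal points of [g + q] *)

Lemma closed_funD (R : realType) n (g : 'rV[R]_n -> \bar R) (q : 'rV[R]_n -> R) :
  closed_fun g -> continuous (q : 'rV[R]_n -> R^o) ->
  closed_fun (fun z => g z + (q z)%:E)%E.
Proof.
move=> gcl qc; rewrite /closed_fun.
have -> : epigraph (fun z => g z + (q z)%:E)%E =
    (fun p : 'rV[R]_n * R^o => (p.1, p.2 - q p.1 : R^o)) @^-1` epigraph g.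
  by apply/seteqP; split=> p; rewrite /epigraph/= EFinB leeBrDr.
apply: preimage_closed => // p _.
have fst_cvg := @cvg_fst _ _ (nbhs p.1) (nbhs p.2) (nbhs_filter p.2).
have qp : q r.1 @[r --> p] --> (q p.1 : R^o).
  exact: (@cvg_comp _ _ _ _ (q : 'rV[R]_n -> R^o) _ _ _ fst_cvg (qc p.1)).
have sub_cvg : (r.2 - q r.1 : R^o) @[r --> p] --> (p.2 - q p.1 : R^o).
  exact: (cvgB (@cvg_snd _ _ (nbhs p.1) (nbhs p.2) (nbhs_filter p.1)) qp).
exact: (cvg_pair fst_cvg sub_cvg).
Qed.

Lemma proper_funD (R : realType) n (g : 'rV[R]_n -> \bar R) (q : 'rV[R]_n -> R) :
  proper_fun g -> proper_fun (fun z => g z + (q z)%:E)%E.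
Proof.
move=> [gNy [x gxy]]; split=> [z|]; first by rewrite adde_eq_ninfty negb_or gNy.
by exists x; case: (g x) (gNy x) gxy.
Qed.

Lemma argminD_nonempty (R : realType) n (sigma : R) (g : 'rV[R]_n -> \bar R)
    (q : 'rV[R]_n -> R) :
  0 < sigma -> proper_fun g -> closed_fun g -> convex_efun g ->
  continuous (q : 'rV[R]_n -> R^o) -> strongly_convex sigma q ->
  argmin (fun z => g z + (q z)%:E)%E !=set0.
Proof.
move=> s0 gp gcl gc qc sq; apply: (strongly_convex_argmin s0).
- exact: proper_funD.
- exact: closed_funD.
- exact: strongly_convex_efunD.
Qed.

Lemma argminD_growth (R : realType) n (sigma : R) (g : 'rV[R]_n -> \bar R)
    (q : 'rV[R]_n -> R) (z0 : 'rV[R]_n) :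
  0 < sigma -> proper_fun g -> convex_efun g -> strongly_convex sigma q ->
  argmin (fun z => g z + (q z)%:E)%E z0 ->
  g z0 \is a fin_num /\
  forall w, g w \is a fin_num ->
    fine (g z0) + q z0 + sigma / 2 * l2norm (w - z0) ^+ 2 <= fine (g w) + q w.
Proof.
move=> s0 [gNy [x gxy]] gc sq z0min.
have gz0 : g z0 \is a fin_num.
  have := z0min x; move: gxy (gNy x) (gNy z0).
  by case: (g z0) => //; case: (g x).
split=> // w gw; apply: (argmin_growth s0 (strongly_convex_efunD gc sq) z0min).
  by rewrite EFinD fineK.
by rewrite EFinD fineK.
Qed.

Lemma continuous_sqr_l2dist (R : realType) n (k : R) (y : 'rV[R]_n) :
  continuous (fun z : 'rV[R]_n => k * l2norm (z - y) ^+ 2 : R^o).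
Proof.
have kc : continuous (fun r : R => k * r ^+ 2).
  by move=> r; apply: cvgMr; exact: exprn_continuous.
by move=> z; exact: (cvg_comp _ _ (l2dist_continuous (y := y) (x := z)) (kc _)).
Qed.

Lemma continuousD_sqr_l2dist (R : realType) n (q : 'rV[R]_n -> R) (k : R)
    (y : 'rV[R]_n) : continuous (q : 'rV[R]_n -> R^o) ->
  continuous (fun z : 'rV[R]_n => q z + k * l2norm (z - y) ^+ 2 : R^o).
Proof.
by move=> qc z; exact: (cvgD (qc z) (continuous_sqr_l2dist (k := k) (y := y) (x := z))).
Qed.

(** * The composite function and its prox-linear model *)

Section Composite.
Context {R : realType} {d m : nat}.
Context (g : 'rV[R]_d -> \bar R) (h : 'rV[R]_m -> R) (c : 'rV[R]_d -> 'rV[R]_m).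
Context (L beta : R).
Context (g_proper : proper_fun g) (g_closed : closed_fun g).
Context (g_convex : convex_efun g).
Context (h_convex : convex_function [set: 'rV[R]_m] h).
Context (L_ge0 : 0 <= L) (h_lip : l2lipschitz L h).
Context (c_diff : forall x, differentiable c x) (beta_ge0 : 0 <= beta).
Context (c_lip : forall x y : 'rV[R]_d,
  opnorm (jacobian c x - jacobian c y) <= beta * l2norm (x - y)).

Local Notation mu := (L * beta).
Local Notation step := (prox_linear_step g h c).
Local Notation linearized y := (fun z => h (c y + (z - y) *m jacobian c y)).

Lemma linearized_error (y z : 'rV[R]_d) :
  `|h (c z) - linearized y z| <= mu / 2 * l2norm (z - y) ^+ 2.
Proof.
apply: (le_trans (h_lip _ _)); rewrite -mulrA -mulrA ler_wpM2l// mulrA.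
exact: linearization_error.
Qed.

Lemma linearized_convex (y : 'rV[R]_d) : strongly_convex 0 (linearized y).
Proof.
exact: strongly_convex_comp_affine (convex_function_strongly_convex h_convex).
Qed.

Lemma linearized_continuous (y : 'rV[R]_d) :
  continuous (linearized y : 'rV[R]_d -> R^o).
Proof.
apply: (@l2lipschitz_continuous _ _ (L * opnorm (jacobian c y))) => u v.
apply: (le_trans (h_lip _ _)); rewrite -mulrA ler_wpM2l//.
rewrite opprD addrACA subrr add0r -mulmxBl.
rewrite (_ : u - y - (v - y) = u - v); last by rewrite opprB addrA subrK.
exact: l2norm_mulmx_le_opnorm.
Qed.

Lemma comp_weakly_convex : strongly_convex (- mu) (h \o c).
Proof.
apply: (@weakly_convex_of_models _ _ _ _ (fun y => linearized y)) => [y|y|y z].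
- by rewrite /= subrr mul0mx addr0.
- exact: linearized_convex.
- by have := linearized_error y z; rewrite ler_norml => /andP[] /=; lra.
Qed.

Lemma comp_continuous : continuous (h \o c : 'rV[R]_d -> R^o).
Proof.
move=> z; apply: continuous_comp; first exact: differentiable_continuous.
exact: l2lipschitz_continuous h_lip _.
Qed.

Lemma prox_linear_step_growth (t : R) (x : 'rV[R]_d) : 0 < t ->
  let p := step t x in
  g p \is a fin_num /\
  forall w, g w \is a fin_num ->
    fine (g p) + linearized x p + 1 / (2 * t) * l2norm (p - x) ^+ 2
      + 1 / (2 * t) * l2norm (w - p) ^+ 2
    <= fine (g w) + linearized x w + 1 / (2 * t) * l2norm (w - x) ^+ 2.
Proof.
move=> t0 p; have s0 : 0 < 0 + 2 * (1 / (2 * t)).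
  by rewrite add0r mulr_gt0// divr_gt0// mulr_gt0.
have sq := strongly_convexD (linearized_convex x)
  (strongly_convex_sqr_l2norm (1 / (2 * t)) x).
have qc := continuousD_sqr_l2dist (k := 1 / (2 * t)) (y := x)
  (linearized_continuous (y := x)).
have pmin : argmin (fun z => prox_linear_model g h c t z x) p.
  exact: getPex (argminD_nonempty s0 g_proper g_closed g_convex qc sq).
have [gp growth] := argminD_growth s0 g_proper g_convex sq pmin.
split=> // w /growth; rewrite !addrA.
by rewrite [_ / 2](_ : _ = 1 / (2 * t)); [|field; rewrite gt_eqF].
Qed.

(** The proximal term, strongly convex with constant [1/nu], outweighs the weak
    convexity of [h \o c] as soon as [nu mu < 1], and leaves a growth constant
    [1/nu - mu] around the proximal point. *)
Lemma grad_moreau_composite (nu : R) (x : 'rV[R]_d) : 0 < nu -> nu * mu < 1 ->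
  exists p, [/\ grad_moreau nu (composite g h c) x = nu^-1 *: (x - p),
    g p \is a fin_num &
    forall w, g w \is a fin_num ->
      fine (g p) + h (c p) + 1 / (2 * nu) * l2norm (p - x) ^+ 2
        + (nu^-1 - mu) / 2 * l2norm (w - p) ^+ 2
      <= fine (g w) + h (c w) + 1 / (2 * nu) * l2norm (w - x) ^+ 2].
Proof.
move=> nu0 numu; have sE : - mu + 2 * (1 / (2 * nu)) = nu^-1 - mu.
  by field; rewrite gt_eqF.
have s0 : 0 < nu^-1 - mu.
  by rewrite subr_gt0 -(ltr_pM2l nu0) divff ?gt_eqF.
have := strongly_convexD comp_weakly_convex
  (strongly_convex_sqr_l2norm (1 / (2 * nu)) x); rewrite sE => sq.
have qc := continuousD_sqr_l2dist (k := 1 / (2 * nu)) (y := x) comp_continuous.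
have [p pmin] := argminD_nonempty s0 g_proper g_closed g_convex qc sq.
have [gp growth] := argminD_growth s0 g_proper g_convex sq pmin.
have {}growth w : g w \is a fin_num ->
      fine (g p) + h (c p) + 1 / (2 * nu) * l2norm (p - x) ^+ 2
        + (nu^-1 - mu) / 2 * l2norm (w - p) ^+ 2
      <= fine (g w) + h (c w) + 1 / (2 * nu) * l2norm (w - x) ^+ 2.
  by move=> /growth; rewrite /= !addrA.
exists p; split=> //.
have gNy := g_proper.1.
apply: (@grad_moreau_prox _ _ nu (nu^-1 - mu) (fine (g p) + h (c p))) => //.
- by move=> z; rewrite adde_eq_ninfty negb_or gNy.
- by rewrite /composite EFinD fineK.
- move=> w b; rewrite /composite -leeBrDr// -EFinB => gwb.
  have gw : g w \is a fin_num by case: (g w) (gNy w) gwb.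
  have := growth w gw; have : fine (g w) <= b - h (c w) by rewrite -lee_fin fineK.
  lra.
Qed.

(** Two strongly convex problems at [x] with close objectives have close
    minimisers: adding the growth inequality of each at the minimiser of the
    other leaves only the model errors at [p] and at the step. *)
Lemma prox_linear_step_gap (tau K k : R) (x p : 'rV[R]_d) : 0 < tau ->
  g p \is a fin_num ->
  (forall w, g w \is a fin_num ->
    fine (g p) + h (c p) + K * l2norm (p - x) ^+ 2 + k * l2norm (w - p) ^+ 2
    <= fine (g w) + h (c w) + K * l2norm (w - x) ^+ 2) ->
  (1 / (2 * tau) + k) * l2norm (step tau x - p) ^+ 2 <=
    (mu / 2 + 1 / (2 * tau) - K) * l2norm (p - x) ^+ 2
    + (mu / 2 + K - 1 / (2 * tau)) * l2norm (step tau x - x) ^+ 2.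
Proof.
move=> tau0 gp pgrowth; set s := step tau x.
have [gs sgrowth] := prox_linear_step_growth x tau0; rewrite -/s in gs sgrowth.
have := sgrowth p gp; have := pgrowth s gs.
have := linearized_error x p; have := linearized_error x s.
rewrite (l2normC p s) !ler_norml.
move: (l2norm (s - p) ^+ 2) (l2norm (p - x) ^+ 2) (l2norm (s - x) ^+ 2).
move: (h (c s)) (h (c p)) (h _) (h _) (fine (g s)) (fine (g p)).
move: (mu) (1 / (2 * tau)) => mu' kappa a1 a2 a3 a4 a5 a6 e1 e2 e3.
by move=> /andP[? ?] /andP[? ?] ? ?; lra.
Qed.

(** Writing [A] and [B] for the lengths of the two steps, the growth
    inequalities add up to
    [(1/r + 1/t) (A - B)^2 <= (1/r - 1/t) (A^2 - B^2)]; if [A > B], dividing by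
    [A - B] leaves [A / t <= B / r]. *)
Lemma prox_linear_step_scaling (r t : R) (x : 'rV[R]_d) : 0 < r -> r <= t ->
  l2norm (step t x - x) <= t / r * l2norm (step r x - x).
Proof.
move=> r0 rt; have t0 : 0 < t by exact: lt_le_trans rt.
have [] := prox_linear_step_growth x r0; have [] := prox_linear_step_growth x t0.
set a := step t x; set b := step r x.
move=> ga agrowth gb bgrowth; have := agrowth b gb; have := bgrowth a ga.
have := l2norm_triangle (a - b) (b - x); rewrite addrA subrK (l2normC b a).
have := l2norm_ge0 (a - b); have := l2norm_ge0 (a - x); have := l2norm_ge0 (b - x).
move: (l2norm (a - b)) (l2norm (a - x)) (l2norm (b - x)) => D A B.
move: (h _) (h _) (fine (g a)) (fine (g b)) => a1 a2 a3 a4.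
clear -r0 t0 rt => B0 A0 D0 ABD bg ag.
have H : (r^-1 + t^-1) * D ^+ 2 <= (r^-1 - t^-1) * (A ^+ 2 - B ^+ 2).
  have -> : r^-1 = 2 * (1 / (2 * r)) by field; rewrite gt_eqF.
  have -> : t^-1 = 2 * (1 / (2 * t)) by field; rewrite gt_eqF.
  move: (1 / (2 * r)) (1 / (2 * t)) ag bg => u v; lra.
rewrite leNgt; apply/negP => BA.
have {}BA : t * B < A * r by move: BA; rewrite mulrAC ltr_pdivrMr.
have AB : B < A by nra.
have AB2 : (A - B) ^+ 2 <= D ^+ 2.
  by rewrite ler_pXn2r ?nnegrE ?subr_ge0 ?(ltW AB)//; lra.
have : (r^-1 + t^-1) * (A - B) ^+ 2 <= (r^-1 - t^-1) * (A ^+ 2 - B ^+ 2).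
  by apply: le_trans H; rewrite ler_wpM2l// addr_ge0// invr_ge0 ltW.
rewrite -(ler_pM2l (mulr_gt0 r0 t0)).
rewrite [leLHS](_ : _ = (A - B) * ((t + r) * (A - B))); last first.
  by field; rewrite !gt_eqF.
rewrite [leRHS](_ : _ = (A - B) * ((t - r) * (A + B))); last first.
  by field; rewrite !gt_eqF.
by rewrite ler_pM2l ?subr_gt0//; lra.
Qed.

Lemma prox_gradient_bounds (t : R) (x : 'rV[R]_d) : 0 < t ->
  let gradF := grad_moreau (t / (1 + t * mu)) (composite g h c) x in
  let G := prox_gradient g h c t x in
  1 / ((1 + mu * t) * (1 + Num.sqrt (mu * t))) * l2norm gradF <= l2norm G /\
  l2norm G <= (1 + 2 * t * mu) / (1 + t * mu)
              * (Num.sqrt (t * mu / (1 + t * mu)) + 1) * l2norm gradF.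
Proof.
move=> t0 gradF G.
have mu0 : 0 <= mu by exact: mulr_ge0.
have tmu0 : 0 <= t * mu by rewrite mulr_ge0// ltW.
have tmu1 : 0 < 1 + t * mu by lra.
have tmu2 : 0 < 1 + 2 * t * mu by lra.
have nu0 : 0 < t / (1 + t * mu) by exact: divr_gt0.
have numu : t / (1 + t * mu) * mu < 1.
  by rewrite mulrAC ltr_pdivrMr// mul1r ltrDr.
have [p [gradE gp growth]] := grad_moreau_composite x nu0 numu.
pose P := l2norm (p - x); pose A := l2norm (step t x - x).
have gradF_norm : l2norm gradF = (1 + t * mu) / t * P.
  by rewrite /gradF gradE l2normZ l2normC gtr0_norm ?invr_gt0// invf_div.
have G_norm : l2norm G = t^-1 * A.
  by rewrite /G /prox_gradient l2normZ l2normC gtr0_norm ?invr_gt0.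
pose K := mu / 2 + 1 / (2 * t).
have {}growth w : g w \is a fin_num ->
    fine (g p) + h (c p) + K * l2norm (p - x) ^+ 2 + 1 / (2 * t) * l2norm (w - p) ^+ 2
    <= fine (g w) + h (c w) + K * l2norm (w - x) ^+ 2.
  move=> /growth.
  rewrite (_ : 1 / (2 * (t / (1 + t * mu))) = K); last first.
    by rewrite /K; field; rewrite !gt_eqF.
  rewrite (_ : ((t / (1 + t * mu))^-1 - mu) / 2 = 1 / (2 * t))//.
  by field; rewrite !gt_eqF.
(* for [tau = t] the coefficient of the error at [p] vanishes *)
have gap_t : l2norm (step t x - p) <= Num.sqrt (t * mu) * A.
  apply: ler_sqrtM => //; try exact: l2norm_ge0.
  have := prox_linear_step_gap t0 gp growth; rewrite -/A -/P /K.
  move: (l2norm _) => D.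
  rewrite [leLHS](_ : _ = t^-1 * D ^+ 2); last by field; rewrite gt_eqF.
  rewrite [leRHS](_ : _ = mu * A ^+ 2); last by field; rewrite gt_eqF.
  by rewrite ler_pdivrMl// -(mulrA t).
(* as [1 / r = 1 / t + 2 mu], the coefficient of the error at the step vanishes *)
pose r := t / (1 + 2 * t * mu).
have r0 : 0 < r by exact: divr_gt0.
have gap_r : l2norm (step r x - p) <= Num.sqrt (t * mu / (1 + t * mu)) * P.
  apply: ler_sqrtM; [by rewrite divr_ge0// ltW|exact: l2norm_ge0|exact: l2norm_ge0|].
  have := prox_linear_step_gap r0 gp growth; rewrite -/P /K.
  move: (l2norm (step r x - p)) (l2norm (step r x - x)) => D B.
  rewrite [leLHS](_ : _ = (1 + t * mu) / t * D ^+ 2); last first.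
    by rewrite /r; field; rewrite !gt_eqF.
  rewrite [leRHS](_ : _ = mu * P ^+ 2); last first.
    by rewrite /r; field; rewrite !gt_eqF.
  rewrite -ler_pdivlMl ?divr_gt0// invf_div => /le_trans -> //.
  by rewrite le_eqVlt; apply/orP; left; apply/eqP; ring.
have rt : r <= t by rewrite ler_pdivrMr// ler_peMr ?(ltW t0)//; lra.
have scaling : A <= (1 + 2 * t * mu) * l2norm (step r x - x).
  have := prox_linear_step_scaling x r0 rt.
  by rewrite (_ : t / r = 1 + 2 * t * mu)// /r; field; rewrite !gt_eqF.
have P_le : P <= l2norm (step t x - p) + A.
  by rewrite (l2normC _ p) /P /A -{1}(subrK (step t x) p) -addrA l2norm_triangle.
have B_le : l2norm (step r x - x) <= l2norm (step r x - p) + P.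
  by rewrite -{1}(subrK p (step r x)) -addrA l2norm_triangle.
rewrite gradF_norm G_norm; split.
- rewrite [mu * t]mulrC.
  have q0 : 0 < 1 + Num.sqrt (t * mu) by rewrite ltr_pwDl ?sqrtr_ge0.
  rewrite (_ : _ * _ = t^-1 * ((1 + Num.sqrt (t * mu))^-1 * P)); last first.
    by field; rewrite !gt_eqF.
  rewrite ler_pM2l ?invr_gt0// ler_pdivrMl//.
  by rewrite (le_trans P_le)// mulrDl mul1r addrC lerD2l.
- rewrite (_ : _ * _ * _ = t^-1 * ((1 + 2 * t * mu)
      * ((Num.sqrt (t * mu / (1 + t * mu)) + 1) * P))); last first.
    by field; rewrite !gt_eqF.
  rewrite ler_pM2l ?invr_gt0// (le_trans scaling)// ler_pM2l//.
  by rewrite (le_trans B_le)// mulrDl mul1r lerD2r.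
Qed.

End Composite.

Theorem theorem4p5 (R : realType) (d m : nat)
  (g : 'rV[R]_d -> \bar R) (h : 'rV[R]_m -> R) (c : 'rV[R]_d -> 'rV[R]_m)
  (L beta : R)
  (g_proper : proper_fun g) (g_closed : closed_fun g) (g_convex : convex_efun g)
  (h_convex : convex_function [set: 'rV[R]_m] h)
  (L_ge0 : 0 <= L) (h_lip : l2lipschitz L h)
  (c_C1 : C1_smooth c) (beta_ge0 : 0 <= beta)
  (c_lip : forall x y : 'rV[R]_d,
     opnorm (jacobian c x - jacobian c y) <= beta * l2norm (x - y))
  (x : 'rV[R]_d) (t : R) (t_gt0 : 0 < t) :
  let mu := L * beta in
  let nu := t / (1 + t * mu) in
  let gradF := grad_moreau nu (composite g h c) x in
  let G := prox_gradient g h c t x in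
  1 / ((1 + mu * t) * (1 + Num.sqrt (mu * t))) * l2norm gradF <= l2norm G /\
  l2norm G <= (1 + 2 * t * mu) / (1 + t * mu)
              * (Num.sqrt (t * mu / (1 + t * mu)) + 1) * l2norm gradF.
Proof.
exact: (prox_gradient_bounds g_proper g_closed g_convex h_convex L_ge0 h_lip
  c_C1.1 beta_ge0 c_lip x t_gt0).
Qed.
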